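(* Let $n\in\{1,2,\dots\}$, $\beta>0$ and $0<a<1$. The law of the $a$-remainder of the Erlang law $\mathfrak{E}_n(\beta)$ is a finite mixture, with binomial weights $\mathfrak{B}(n,1-a)$, of the Erlang laws $\mathfrak{E}_k(\beta)$, $k=0,1,\dots,n$, with characteristic function $$\chi_a(u,n,\beta)=\sum_{k=0}^n\binom{n}{k}a^{n-k}(1-a)^k\left(\frac{\beta}{\beta-iu}\right)^k$$ and (generalized) density $$g_a(x,n,\beta)=a^n\delta(x)+\sum_{k=1}^n\binom{n}{k}a^{n-k}(1-a)^k f_{k,\beta}(x),$$ where the absolutely continuous part is supported on $x>0$.
   Context: For $k=1,2,\dots$ and $\beta>0$, the Erlang law $\mathfrak{E}_k(\beta)$ has density $f_{k,\beta}(x)=\frac{\beta}{(k-1)!}(\beta x)^{k-1}e^{-\beta x}$ for $x>0$ (and $0$ otherwise) and characteristic function $\left(\frac{\beta}{\beta-iu}\right)^k$; $\mathfrak{E}_0(\beta)$ is the law degenerate at $0$. The law $\mathfrak{E}_n(\beta)$, with characteristic function $\varphi$, is self-decomposable: for every $0<a<1$ there is a probability law, called the law of the $a$-remainder, with characteristic function $\chi_a$ such that $\varphi(u)=\varphi(au)\chi_a(u)$, that is $\chi_a(u)=\left(\frac{\beta-iau}{\beta-iu}\right)^n$. $\mathfrak{B}(n,p)$ is the binomial law with $n$ trials and success probability $p$. $\delta$ is the Dirac delta at $0$, so a density containing a term $c\,\delta(x)$ denotes a law with an atom of mass $c$ at $0$. *)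

(* Defs.v *)
From HB Require Import structures.
From mathcomp Require Import all_boot all_order all_algebra.
From mathcomp Require Import all_classical all_reals all_analysis.
From mathcomp Require Import measurable_realfun complex.
From mathcomp Require Import ring lra.

Set Implicit Arguments.
Unset Strict Implicit.
Unset Printing Implicit Defensive.

Import Order.TTheory GRing.Theory Num.Theory.
Import numFieldNormedType.Exports.

Local Open Scope classical_set_scope.
Local Open Scope complex_scope.
Local Open Scope ring_scope.

(* The density is meant for [0 < k]; the law for [k = 0] has no density. *)
Definition erlang_pdf {R : realType} (k : nat) (beta x : R) : R :=
  if 0 < x then
    beta / (k.-1)`!%:R * (beta * x) ^+ k.-1 * expR (- (beta * x))
  else 0.

(* The case [beta <= 0] is a default value that makes the law a probability
   measure for all values of the parameters. *)
Definition erlang_prob {R : realType} (k : nat) (beta : R) :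
    set (measurableTypeR R) -> \bar R :=
  fun A => if (0 < k)%N && (0 < beta) then
    (\int[lebesgue_measure]_(x in A) (erlang_pdf k beta x)%:E)%E
  else \d_(0 : measurableTypeR R) A.

Section erlang.
Context {R : realType}.
Notation mu := (@lebesgue_measure R).
Implicit Types (k : nat) (beta x : R).

Lemma erlang_pdf_ge0 k beta x : 0 < beta -> 0 <= erlang_pdf k beta x.
Proof.
move=> b0; rewrite /erlang_pdf; case: ifPn => // x0.
rewrite !mulr_ge0 ?expR_ge0 ?exprn_ge0 ?invr_ge0 ?ler0n ?ltW//.
by rewrite mulr_gt0.
Qed.

Let g beta k x : R := beta / k`!%:R * (beta * x) ^+ k * expR (- (beta * x)).

Let t beta k x : R := (beta * x) ^+ k / k`!%:R * expR (- (beta * x)).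

Let G beta k x : R := - \sum_(j < k.+1) t beta j x.

Let is_derive_e beta x :
  is_derive x 1 (fun x => expR (- (beta * x))) (- beta * expR (- (beta * x))).
Proof. by apply: is_derive_eq; rewrite /= /GRing.scale/=; ring. Qed.

Let is_derive_t beta k x :
  is_derive x 1 (t beta k.+1) (g beta k x - g beta k.+1 x).
Proof.
have He := is_derive_e beta x.
have -> : t beta k.+1 = (k.+1)`!%:R^-1 \*:
    ((beta \*: (id : R -> R)) ^+ k.+1 * (fun x => expR (- (beta * x)))).
  by apply/funext => y; rewrite /t /= fctE exprfctE /= /GRing.scale/=; ring.
apply: is_derive_eq.
rewrite /g fctE /= /GRing.scale/= factS natrM exprS.
have h1 : (k`!%:R : R) != 0 by rewrite pnatr_eq0 -lt0n fact_gt0.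
have h2 : (k.+1%:R : R) != 0 by rewrite pnatr_eq0.
by field; rewrite h1 addrC natr1 h2.
Qed.

Let is_derive_G beta k x : is_derive x 1 (G beta k) (g beta k x).
Proof.
elim: k => [|k IH].
  have -> : G beta 0 = fun x => - expR (- (beta * x)).
    by apply/funext => y; rewrite /G big_ord1 /t expr0 fact0 divr1 mul1r.
  have He := is_derive_e beta x.
  by apply: is_derive_eq; rewrite /g fact0 expr0 divr1; ring.
have -> : G beta k.+1 = (fun x => G beta k x - t beta k.+1 x).
  by apply/funext => y; rewrite /G big_ord_recr/= opprD.
have Ht := is_derive_t beta k x.
by apply: is_derive_eq; ring.
Qed.

Let cvg_t beta k : 0 < beta -> t beta k x @[x --> +oo] --> 0.
Proof.
move=> b0.
have h : (k.+1%:R / beta) * x^-1 @[x --> +oo] --> 0.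
  rewrite -[X in _ --> X](mulr0 (k.+1%:R / beta)).
  apply: cvgM; first exact: cvg_cst.
  by apply/gtr0_cvgV0; [exact: nbhs_pinfty_gt|exact: cvg_id].
apply: (@squeeze_cvgr _ _ _ _ (fun=> 0) (fun x => (k.+1%:R / beta) * x^-1)) => //;
  last exact: cvg_cst.
near=> x.
have x0 : 0 < x by near: x; exact: nbhs_pinfty_gt.
have bx0 : 0 < beta * x by rewrite mulr_gt0.
have kf : 0 < (k`!%:R : R) by rewrite ltr0n fact_gt0.
apply/andP; split.
  by rewrite /t !mulr_ge0 ?expR_ge0 ?exprn_ge0 ?invr_ge0 ?ler0n ?ltW.
have := expR_ge1Dxn k (ltW bx0).
rewrite /t expRN -mulrA -invfM.
rewrite factS natrM exprS => hx.
have e0 := expR_gt0 (beta * x).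
rewrite ler_pdivrMr ?mulr_gt0//.
have -> : k.+1%:R / beta * x^-1 * (k`!%:R * expR (beta * x)) =
   (k.+1%:R * k`!%:R / (beta * x)) * expR (beta * x).
  by field; rewrite !gt_eqF.
apply: (@le_trans _ _ (k.+1%:R * k`!%:R / (beta * x) *
    (beta * x * (beta * x) ^+ k / (k.+1%:R * k`!%:R)))).
  rewrite le_eqVlt; apply/orP; left; apply/eqP.
  have h2 : (k.+1%:R : R) != 0 by rewrite pnatr_eq0.
  by field; rewrite addrC natr1 h2 !gt_eqF.
rewrite ler_pM2l ?divr_gt0 ?mulr_gt0 ?ltr0n ?fact_gt0//.
by apply: le_trans hx; rewrite lerDr.
Unshelve. all: by end_near. Qed.

Let cvg_G beta k : 0 < beta -> G beta k x @[x --> +oo] --> 0.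
Proof.
move=> b0; rewrite /G -[X in _ --> X]oppr0; apply: cvgN.
elim: k.+1 => [|m IH].
  by under eq_fun do rewrite big_ord0; exact: cvg_cst.
under eq_fun do rewrite big_ord_recr/=.
by have := cvgD IH (cvg_t m b0); rewrite addr0; exact.
Qed.

Let continuous_g beta k : continuous (g beta k).
Proof.
move=> x; apply: differentiable_continuous; apply/derivable1_diffP.
have He := is_derive_e beta x.
have -> : g beta k = (beta / k`!%:R) \*:
    ((beta \*: (id : R -> R)) ^+ k * (fun x => expR (- (beta * x)))).
  by apply/funext => y; rewrite /g /= fctE exprfctE /= /GRing.scale/=; ring.
exact: ex_derive.
Qed.

Let measurable_g beta k : measurable_fun setT (g beta k).
Proof.
by apply: continuous_measurable_fun; exact: continuous_g.
Qed.

Let erlang_pdf_restrict k beta :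
  erlang_pdf k beta = g beta k.-1 \_ `]0, +oo[.
Proof.
apply/funext => x; rewrite patchE /erlang_pdf /g.
case: ifPn => x0; first by rewrite ifT// inE/= in_itv/= x0.
by rewrite ifF//; apply: memNset; rewrite /= in_itv/= andbT; exact/negP.
Qed.

Lemma measurable_erlang_pdf k beta :
  measurable_fun [set: measurableTypeR R] (erlang_pdf k beta).
Proof.
rewrite erlang_pdf_restrict; apply/measurable_restrict => //.
by rewrite setTI; exact: measurable_funTS (measurable_g _ _).
Qed.

Lemma integral_erlang_pdf k beta : 0 < beta ->
  (\int[mu]_x (erlang_pdf k beta x)%:E = 1)%E.
Proof.
move=> b0; rewrite erlang_pdf_restrict.
rewrite -[X in integral _ _ X]/(EFin \o _) -restrict_EFin.
rewrite -integral_mkcond integral_itv_obnd_cbnd; last first.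
  by apply/measurable_EFinP; exact: measurable_funTS (measurable_g _ _).
rewrite (@ge0_continuous_FTC2y _ _ (G beta k.-1) _ 0).
- rewrite /G big_ord_recl big1 => [|i _]; rewrite /t mulr0 oppr0 expR0.
    by rewrite expr0 fact0 divr1 mulr1 addr0 -EFinB opprK add0r.
  by rewrite expr0n/= mul0r mul0r.
- move=> x x0; have bx0 : 0 <= beta * x by rewrite mulr_ge0// ltW.
  by rewrite /g !mulr_ge0 ?expR_ge0 ?exprn_ge0 ?invr_ge0 ?ler0n// ltW.
- by apply: continuous_subspaceT; exact: continuous_g.
- exact: cvg_G.
- by move=> x _; have h := is_derive_G beta k.-1 x; exact: ex_derive.
- apply: cvg_at_right_filter.
  apply: differentiable_continuous; apply/derivable1_diffP.
  by have h := is_derive_G beta k.-1 0; exact: ex_derive.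
- by move=> x _; rewrite derive1E;
    have h := is_derive_G beta k.-1 x; rewrite derive_val.
Qed.

Variables (k : nat) (beta : R).

Let erlang0 : erlang_prob k beta set0 = 0%E.
Proof. by rewrite /erlang_prob integral_set0 measure0; case: ifP. Qed.

Let erlang_ge0 A : (0 <= erlang_prob k beta A)%E.
Proof.
rewrite /erlang_prob; case: ifPn => // /andP[_ b0].
by apply: integral_ge0 => x _; rewrite lee_fin erlang_pdf_ge0.
Qed.

Let erlang_sigma_additive : semi_sigma_additive (erlang_prob k beta).
Proof.
move=> /= F mF tF mUF; rewrite /erlang_prob.
case: ifPn => [/andP[_ b0]|_]; last exact: measure_semi_sigma_additive.
apply: cvg_toP.
  apply: ereal_nondecreasing_is_cvgn => m n mn.
  apply: lee_sum_nneg_natr => // i _ _; apply: integral_ge0 => /= x Fkx.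
  by rewrite lee_fin erlang_pdf_ge0.
rewrite ge0_integral_bigcup//=.
- apply/measurable_funTS/measurableT_comp => //.
  exact: measurable_erlang_pdf.
- by move=> x _; rewrite lee_fin erlang_pdf_ge0.
Qed.

HB.instance Definition _ := isMeasure.Build _ _ _
  (erlang_prob k beta) erlang0 erlang_ge0 erlang_sigma_additive.

Let erlang_setT : erlang_prob k beta [set: _] = 1%E.
Proof.
rewrite /erlang_prob; case: ifPn => [/andP[_ b0]|_].
  exact: integral_erlang_pdf.
exact: probability_setT.
Qed.

HB.instance Definition _ :=
  @Measure_isProbability.Build _ _ R (erlang_prob k beta) erlang_setT.

End erlang.

(* Real and imaginary parts of the expectation of [exp (i u X)] under [P]. *)
Definition charfun {R : realType} (P : probability (measurableTypeR R) R)
    (u : R) : R[i] :=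
  (\int[P]_x cos (u * x)) +i* (\int[P]_x sin (u * x)).

Definition remainder_law {R : realType} (a : R)
    (P Q : probability (measurableTypeR R) R) : Prop :=
  forall u : R, charfun P u = charfun P (a * u) * charfun Q u.

Definition remainder_pdf {R : realType} (n : nat) (beta a x : R) : R :=
  \sum_(1 <= k < n.+1)
    'C(n, k)%:R * a ^+ (n - k) * (1 - a) ^+ k * erlang_pdf k beta x.

(* Main.v *)
(* The law with characteristic function ((beta - iau) / (beta - iu))^n is the
   binomial mixture, since the base equals a + (1 - a) beta / (beta - iu) and
   the binomial formula applies.  The Erlang characteristic function follows
   from the Stein-type recurrence
     E_(k+1) f' = beta (E_(k+1) f - E_k f),
   an integration by parts.  Since the characteristic function of the Erlang
   law vanishes nowhere, that of the remainder is determined, and it remains to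
   see that a law P on the line is determined by its characteristic function.
   Products of sines are combinations of sines and cosines, so all moments of
   sin (u X) are determined; by the exponential series, if all moments of a
   bounded function f are determined then so are those of exp (c f).  Applying
   this twice to sin (y / N), the integrals of
     exp (- exp (- N (N d_N(y) - 1))),  d_N(y) = N sin (y / N) - N sin (a / N),
   are determined; as d_N(y) --> y - a, these functions converge boundedly to
   the indicator of ]a, +oo[. *)

Require Import Defs.
From HB Require Import structures.
From mathcomp Require Import all_boot all_order all_algebra.
From mathcomp Require Import all_classical all_reals all_analysis.
From mathcomp Require Import complex.
From mathcomp Require Import measurable_realfun ring.

Set Implicit Arguments.
Unset Strict Implicit.
Unset Printing Implicit Defensive.

Import Order.TTheory GRing.Theory Num.Theory.
Import numFieldNormedType.Exports.

Local Open Scope classical_set_scope.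
Local Open Scope complex_scope.
Local Open Scope ring_scope.

(** * Bounded functions under probability laws and equality of all their moments *)

Section bounded_expectation.
Context d (T : measurableType d) (R : realType).
Implicit Types (P Q : probability T R) (f g : T -> R).

Lemma bounded_integrable P f (M : R) : measurable_fun setT f ->
  (forall x, `|f x| <= M) -> P.-integrable setT (EFin \o f).
Proof.
move=> mf fM; apply: measurable_bounded_integrable => //.
  by rewrite (le_lt_trans (probability_le1 P _))// ltry.
exists M; split; first by rewrite num_real.
by move=> y My x _; exact: le_trans (fM x) (ltW My).
Qed.

(** Dominated convergence: a constant is integrable for a probability, so the uniform bound [M]
    dominates. *)
Lemma cvg_Rintegral_bounded P (f_ : (T -> R)^nat) f (M : R) :
  (forall n, measurable_fun setT (f_ n)) -> (forall n x, `|f_ n x| <= M) ->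
  (forall x, f_ ^~ x @ \oo --> f x) ->
  \int[P]_x f_ n x @[n --> \oo] --> \int[P]_x f x.
Proof.
move=> mf fM ff; apply: fine_cvg.
have mfoo : measurable_fun setT f.
  by apply: (measurable_fun_cvg mf) => x _; exact: ff.
have fMoo x : `|f x| <= M.
  rewrite -(cvg_lim (@Rhausdorff R) (cvg_norm (ff x))).
  apply: limr_le; first by apply/cvg_ex; eexists; exact: cvg_norm (ff x).
  by near=> n; exact: fM.
rewrite fineK; last first.
  by apply: integrable_fin_num => //; exact: bounded_integrable mfoo fMoo.
apply: (dominated_cvg _ _ (g := cst M%:E)) => //.
- by move=> n; apply/measurable_EFinP.
- by move=> x _ /=; apply: cvg_EFin; [exact: nearW|exact: ff].
- exact: finite_measure_integrable_cst.
- by move=> n x _ /=; rewrite lee_fin.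
Unshelve. all: by end_near. Qed.

(** Measurability and boundedness are part of the notion so that it is stable under [f] to
    [exp (c f)] and can be applied repeatedly. *)
Definition equal_moments P Q f := [/\ measurable_fun setT f,
  exists M, forall x, `|f x| <= M &
  forall m, \int[P]_x (f x ^+ m) = \int[Q]_x (f x ^+ m)].

(** The [m]-th power of [exp (c f)] is [exp (b f)] with [b = m c]. Partial sums of its exponential
    series are polynomials in [f], so their integrals agree, and they are bounded by [exp (|b| M)],
    so the integrals pass to the limit. *)
Lemma equal_moments_expR P Q f (c : R) : equal_moments P Q f ->
  equal_moments P Q (fun x => expR (c * f x)).
Proof.
move=> [mf [M fM] PQf].
have fnM (b : R) x : `|b * f x| <= `|b| * M by rewrite normrM ler_wpM2l.
split.
- by apply: measurableT_comp => //; exact: measurable_funM.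
- exists (expR (`|c| * M)) => x; rewrite ger0_norm ?expR_ge0// ler_expR.
  exact: le_trans (ler_norm _) (fnM _ _).
move=> m.
pose b := m%:R * c.
pose s n x := series (exp_coeff (b * f x)) n.
have -> : (fun x => expR (c * f x) ^+ m) = (fun x => expR (b * f x)).
  by apply/funext => x; rewrite -expRM_natl mulrA.
have sn x : s ^~ x @ \oo --> expR (b * f x).
  exact: is_cvg_series_exp_coeff.
have ms n : measurable_fun setT (s n).
  rewrite /s /series/=; apply: measurable_sum => i.
  apply: measurable_funM => //; apply: measurable_funX.
  exact: measurable_funM.
have sM n x : `|s n x| <= expR (`|b| * M).
  rewrite /s /series/=; apply: le_trans (ler_norm_sum _ _ _) _.
  (* Termwise comparison with the series at [|b| M], whose nonnegative terms keep the partial sums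
     below its limit. *)
  apply: (@le_trans _ _ (series (exp_coeff (`|b| * M)) n)).
    apply: ler_sum => i _; rewrite normrM normrX normfV [X in _ / X]ger0_norm//.
    by rewrite ler_wpM2r ?invr_ge0// lerXn2r ?nnegrE// (le_trans _ (fnM b x)).
  apply: nondecreasing_cvgn_le; last exact: is_cvg_series_exp_coeff.
  apply: nondecreasing_series => i _ _; apply: exp_coeff_ge0.
  exact: le_trans (fnM b x).
have PQs n : \int[P]_x s n x = \int[Q]_x s n x.
  have E (W : probability T R) : \int[W]_x s n x =
      \sum_(0 <= i < n) (b ^+ i / i`!%:R) * \int[W]_x (f x ^+ i).
    rewrite /s /series/=.
    elim: n => [|n IH].
      under eq_Rintegral do rewrite big_geq//.
      by rewrite big_geq// Rintegral_cst// mul0r.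
    rewrite big_nat_recr//= -IH; under eq_Rintegral do rewrite big_nat_recr//=.
    have bs i : W.-integrable setT (EFin \o (fun x => f x ^+ i)).
      apply: (@bounded_integrable _ _ (M ^+ i)); first exact: measurable_funX.
      by move=> x; rewrite normrX lerXn2r// nnegrE (le_trans _ (fM x)).
    rewrite RintegralD//.
    - congr +%R; rewrite -RintegralZl//; apply: eq_Rintegral => x _.
      by rewrite /exp_coeff/= exprMn mulrAC.
    - exact: bounded_integrable (ms n) (sM n).
    - apply: (@bounded_integrable _ _ (`|b ^+ n / n`!%:R| * M ^+ n)).
        apply: measurable_funM => //; apply: measurable_funX.
        exact: measurable_funM.
      move=> x; rewrite /exp_coeff/= exprMn mulrAC normrM ler_wpM2l// normrX.
      by rewrite lerXn2r// nnegrE (le_trans _ (fM x)).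
  by rewrite !E; apply: eq_bigr => i _; rewrite PQf.
have E (W : probability T R) :
    \int[W]_x s n x @[n --> \oo] --> \int[W]_x expR (b * f x).
  exact: cvg_Rintegral_bounded ms sM sn.
(* One sequence of integrals gets two limits, the expectations under [P] and under [Q]. *)
have cP : \int[Q]_x s n x @[n --> \oo] --> \int[P]_x expR (b * f x).
  by under eq_fun do rewrite -PQs; exact: E.
exact: cvg_unique cP (E Q).
Qed.

End bounded_expectation.

(** * A law on the line is determined by its characteristic function *)

Section charfun_uniqueness.
Context {R : realType}.
Implicit Types (P Q : probability (measurableTypeR R) R) (u v : R).

Lemma measurable_sinM u :
  measurable_fun setT (fun x : measurableTypeR R => sin (u * x)).
Proof.
apply: continuous_measurable_fun => x; apply: continuous_comp.
  exact: mulrl_continuous.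
exact: continuous_sin.
Qed.

Lemma measurable_cosM u :
  measurable_fun setT (fun x : measurableTypeR R => cos (u * x)).
Proof.
apply: continuous_measurable_fun => x; apply: continuous_comp.
  exact: mulrl_continuous.
exact: continuous_cos.
Qed.

(** By the product-to-sum formulas, one factor [sin (u x)] is traded for a shift of the frequency
    [v] to [u + v] and [u - v], which exchanges sine and cosine in the other factor. *)
Lemma equal_moments_sinM P Q u : (forall v, charfun P v = charfun Q v) ->
  equal_moments P Q (fun x => sin (u * x)).
Proof.
move=> PQ; split; [exact: measurable_sinM|by exists 1 => x; exact: sin_max|].
have ms m v : measurable_fun setT
    (fun x : measurableTypeR R => sin (u * x) ^+ m * sin (v * x)).
  by apply: measurable_funM; [apply: measurable_funX|]; exact: measurable_sinM.
have mc m v : measurable_fun setT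
    (fun x : measurableTypeR R => sin (u * x) ^+ m * cos (v * x)).
  apply: measurable_funM; last exact: measurable_cosM.
  by apply: measurable_funX; exact: measurable_sinM.
have s1 m x : `|sin (u * x) ^+ m| <= 1 by rewrite normrX exprn_ile1// sin_max.
have ims m v (W : probability (measurableTypeR R) R) :
    W.-integrable setT (EFin \o (fun x => sin (u * x) ^+ m * sin (v * x))).
  apply: (@bounded_integrable _ _ _ _ _ 1) (ms m v) _ => x.
  by rewrite normrM mulr_ile1// sin_max.
have imc m v (W : probability (measurableTypeR R) R) :
    W.-integrable setT (EFin \o (fun x => sin (u * x) ^+ m * cos (v * x))).
  apply: (@bounded_integrable _ _ _ _ _ 1) (mc m v) _ => x.
  by rewrite normrM mulr_ile1// cos_max.
have Ic m v (W : probability (measurableTypeR R) R) :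
    \int[W]_x (sin (u * x) ^+ m.+1 * cos (v * x)) =
    2^-1 * (\int[W]_x (sin (u * x) ^+ m * sin ((u + v) * x)) +
            \int[W]_x (sin (u * x) ^+ m * sin ((u - v) * x))).
  rewrite -(RintegralD measurableT (ims _ _ _) (ims _ _ _)).
  rewrite -(RintegralZl _ measurableT
    (integrableD measurableT (ims _ _ _) (ims _ _ _))).
  by apply: eq_Rintegral => x _; rewrite !mulrDl mulNr sinD sinB exprS; field.
have Is m v (W : probability (measurableTypeR R) R) :
    \int[W]_x (sin (u * x) ^+ m.+1 * sin (v * x)) =
    2^-1 * (\int[W]_x (sin (u * x) ^+ m * cos ((u - v) * x)) -
            \int[W]_x (sin (u * x) ^+ m * cos ((u + v) * x))).
  rewrite -(RintegralB measurableT (imc _ _ _) (imc _ _ _)).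
  rewrite -(RintegralZl _ measurableT
    (integrableB measurableT (imc _ _ _) (imc _ _ _))).
  by apply: eq_Rintegral => x _; rewrite !mulrDl mulNr cosB cosD exprS; field.
(* Both kinds of integrals and all frequencies go together through the induction on [m]. The case
   [m = 0] is the equality of characteristic functions; the cosine part at [v = 0] gives the moments
   of [sin (u x)]. *)
have H m v : \int[P]_x (sin (u * x) ^+ m * sin (v * x)) =
             \int[Q]_x (sin (u * x) ^+ m * sin (v * x)) /\
             \int[P]_x (sin (u * x) ^+ m * cos (v * x)) =
             \int[Q]_x (sin (u * x) ^+ m * cos (v * x)).
  elim: m v => [v|m IH v].
    have [] := PQ v.
    under [in X in _ -> _ -> X]eq_Rintegral do rewrite expr0 mul1r.
    under [in X in _ -> _ -> _ = X /\ _]eq_Rintegral do rewrite expr0 mul1r.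
    under [in X in _ -> _ -> _ /\ X = _]eq_Rintegral do rewrite expr0 mul1r.
    under [in X in _ -> _ -> _ /\ _ = X]eq_Rintegral do rewrite expr0 mul1r.
    by [].
  rewrite (Is m v P) (Is m v Q) (Ic m v P) (Ic m v Q).
  by rewrite !(fun w => (IH w).1) !(fun w => (IH w).2).
move=> m; have [_] := H m 0.
have E (W : probability (measurableTypeR R) R) :
    \int[W]_x (sin (u * x) ^+ m * cos (0 * x)) = \int[W]_x (sin (u * x) ^+ m).
  by apply: eq_Rintegral => x _; rewrite mul0r cos0 mulr1.
by rewrite (E P) (E Q).
Qed.

(** The limit is the derivative of [sin (x h)] at [h = 0], read along the nonzero points
    [h = 1 / (n + 1)]. *)
Lemma cvg_mulr_sin (x : R) : n.+1%:R * sin (x / n.+1%:R) @[n --> \oo] --> x.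
Proof.
have D : is_derive (0 : R) 1 (fun h : R => sin (x * h)) x.
  by apply: is_derive_eq; rewrite mulr0 cos0 /GRing.scale/=; ring.
have := @ex_derive _ _ _ _ _ _ _ D; rewrite /derivable => /cvg_ex[l].
move=> cl; have lx : l = x.
  by rewrite -(@derive_val _ _ _ _ _ _ _ D); exact/esym/cvg_lim.
rewrite {}lx in cl.
have /cvgr_dnbhsP /(_ (fun n => n.+1%:R^-1)) := cl.
rewrite /= => h; rewrite -[X in X @ _](_ : (fun n => n.+1%:R^-1^-1 *:
    (sin (x * (n.+1%:R^-1 *: 1 + 0)) - sin (x * 0))) = _); last first.
  apply/funext => n; rewrite invrK mulr0 sin0 subr0 addr0 /GRing.scale/=.
  by rewrite mulr1.
apply: h; split; last exact: cvg_harmonic.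
by move=> n; rewrite invr_eq0 pnatr_eq0.
Qed.

(* The shift by [- 1] forces the limit to be [0] at [y = a]. *)
Definition smooth_step (a : R) (n : nat) (y : R) : R :=
  let N : R := n.+1%:R in
  expR (- expR (- (N * (N * (N * sin (y / N) - N * sin (a / N)) - 1)))).

(** With [N = n + 1], the quantity [z n = N (N d n - 1)] is eventually at least [N] when [a < y],
    and at most [- N] when [y <= a]. Hence [exp (- z n)] tends to [0] or to [+oo], and
    [exp (- exp (- z n))] to [1] or to [0]. *)
Lemma cvg_smooth_step (a y : R) :
  smooth_step a n y @[n --> \oo] --> (\1_(`]a, +oo[) y : R).
Proof.
pose d n : R := n.+1%:R * sin (y / n.+1%:R) - n.+1%:R * sin (a / n.+1%:R).
have cd : d @ \oo --> y - a by apply: cvgB; exact: cvg_mulr_sin.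
have cN : (n.+1%:R : R) @[n --> \oo] --> +oo.
  by rewrite (cvg_shiftS (fun n => n%:R : R)); exact: cvgr_idn.
pose z n : R := n.+1%:R * (n.+1%:R * d n - 1).
rewrite indicE mem_setE/= in_itv/= andbT.
have [ay|ya] := ltP a y.
- have cz : z @ \oo --> +oo.
    apply: (ger_cvgy _ cN); near=> n.
    have d0 : (y - a) / 2 <= d n.
      near: n; apply: (cvgr_ge _ cd).
      by rewrite ltr_pdivrMr// mulr_natr mulr2n ltrDl subr_gt0.
    rewrite ler_peMr// lerBrDr.
    apply: (@le_trans _ _ (n.+1%:R * ((y - a) / 2))); last by rewrite ler_wpM2l.
    rewrite -ler_pdivrMr ?divr_gt0 ?subr_gt0//.
    by near: n; move/cvgryPge : cN; apply.
  rewrite -[X in _ --> X]expR0 -oppr0 /smooth_step.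
  have h : - expR (- z n) @[n --> \oo] --> - (0 : R).
    by apply: cvgN; exact: (cvg_comp _ _ cz (@cvgr_expR R)).
  exact: (cvg_comp _ _ h (@continuous_expR R _)).
- have cz : - z n @[n --> \oo] --> +oo.
    (* At [y = a] each [d n] is zero; for [y < a] the limit of [d] is negative. *)
    have d0 : \forall n \near \oo, d n <= 0.
      move: ya; rewrite le_eqVlt => /predU1P[ya|ya].
        by apply: nearW => n; rewrite /d ya subrr.
      by apply: (cvgr_le _ cd); rewrite subr_lt0.
    apply: (ger_cvgy _ cN); near=> n.
    have dn0 : d n <= 0 by near: n.
    rewrite -mulrN opprB ler_peMr// lerBrDr.
    by rewrite gerDl mulr_ge0_le0.
  rewrite /smooth_step.
  have cez : expR (- z n) @[n --> \oo] --> +oo.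
    apply: (ger_cvgy _ cz); apply: nearW => n.
    by rewrite (le_trans _ (expR_ge1Dx _))// lerDr.
  exact: (cvg_comp _ _ cez (@cvgr_expR R)).
Unshelve. all: by end_near. Qed.

Lemma equal_moments_smooth_step P Q a n :
  (forall u, charfun P u = charfun Q u) -> equal_moments P Q (smooth_step a n).
Proof.
move=> PQ.
set N : R := n.+1%:R.
(* Expanding [- N (N (N sin (y / N) - N sin (a / N)) - 1)] leaves [- N ^ 3] as the coefficient of
   [sin (y / N)]. The part free of [y] becomes a factor [exp (...)], absorbed into the coefficient
   of the outer exponential. *)
have := equal_moments_expR (- expR (N * (N * (N * sin (a / N)) + 1)))
  (equal_moments_expR (- (N * (N * N))) (equal_moments_sinM N^-1 PQ)).
congr equal_moments; apply/funext => y; rewrite /smooth_step -/N.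
by rewrite mulNr -expRD; congr (expR (- expR _)); rewrite [N^-1 * y]mulrC; ring.
Qed.

(** The half-lines []a, +oo[] are stable under intersection and generate the Borel sets, and those
    with [a = - n] cover the line. It is thus enough to compare [P] and [Q] on them, where both
    masses are limits of the same integrals of [smooth_step]. *)
Lemma charfun_inj P Q : (forall u, charfun P u = charfun Q u) ->
  forall A, measurable A -> P A = Q A.
Proof.
move=> PQ A mA.
apply: (@measure_unique _ _ (measurableTypeR R) (@RGenOInfty.G R)
  (fun n => `](- n%:R)%R, +oo[%classic) _ _ _ _ P Q).
- exact: RGenOInfty.measurableE.
- move=> _ _ [a ->] [b ->]; exists (Num.max a b).
  by apply/seteqP; split => x /=; rewrite !in_itv/= !andbT gt_max => /andP.
- by move=> n; exists (- n%:R).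
- apply/seteqP; split => // x _; exists (Num.trunc `|x|).+1 => //=.
  rewrite in_itv/= andbT ltrNl.
  by rewrite (le_lt_trans (ler_norm _))// normrN truncnS_gt.
- move=> _ [a ->].
  have E (W : probability (measurableTypeR R) R) :
      \int[W]_x smooth_step a n x @[n --> \oo] --> fine (W `]a, +oo[%classic).
    have -> : fine (W `]a, +oo[%classic) = \int[W]_x (\1_(`]a, +oo[) x : R).
      by rewrite /Rintegral integral_indic// setIT.
    apply: (@cvg_Rintegral_bounded _ _ _ _ _ _ 1).
    + move=> n.
      (* Comparing [W] with itself is a way to extract the measurability of [smooth_step]. *)
      by have [] := equal_moments_smooth_step a n (fun u => erefl (charfun W u)).
    + move=> n x; rewrite ger0_norm ?expR_ge0// -expR0 ler_expR.
      by rewrite oppr_le0 expR_ge0.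
    + exact: cvg_smooth_step.
  have PQn n : \int[P]_x smooth_step a n x = \int[Q]_x smooth_step a n x.
    have [_ _ /(_ 1%N)] := equal_moments_smooth_step a n PQ.
    by under eq_Rintegral do rewrite expr1; under [RHS]eq_Rintegral do rewrite expr1.
  have cP : \int[Q]_x smooth_step a n x @[n --> \oo] --> fine (P `]a, +oo[%classic).
    by under eq_fun do rewrite -PQn; exact: E.
  have := cvg_unique _ cP (E Q) => /(_ (@Rhausdorff R)) h.
  by rewrite -[LHS]fineK ?fin_num_measure// h fineK ?fin_num_measure.
- by move=> n; rewrite (le_lt_trans (probability_le1 P _))// ltry.
- exact: mA.
Qed.

End charfun_uniqueness.

(** * Integration by parts for Erlang laws and their characteristic functions *)

Section erlang_charfun.
Context {R : realType}.
Notation mu := (@lebesgue_measure R).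
Implicit Types (k : nat) (beta u x : R).

(** The fundamental theorem on [[0, n + 1]], then dominated convergence with bound [|f|]. The
    function [f] may change sign, and the limit of [F] at infinity is an output. *)
Lemma cvg_FTC2y (F f : R -> R) : (forall x : R, is_derive x 1 F (f x)) ->
  continuous f -> mu.-integrable `[0, +oo[ (EFin \o f) ->
  F n.+1%:R @[n --> \oo] --> F 0 + \int[mu]_(x in `[0, +oo[) f x.
Proof.
move=> dF cf intf.
have cF : continuous F.
  move=> x; apply: differentiable_continuous; apply/derivable1_diffP.
  by have := dF x => h; exact: ex_derive.
have E n : (F n.+1%:R - F 0)%:E =
    (\int[mu]_(x in `[0%R, +oo[) ((f \_ `[0%R, n.+1%:R]) x)%:E)%E.
  rewrite EFinB -(@continuous_FTC2 _ f F 0 n.+1%:R)//.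
  - rewrite [LHS]integral_mkcond [RHS]integral_mkcond.
    apply: eq_integral => x _; rewrite !patchE.
    have [|//] := boolP (x \in `[0, n.+1%:R]%classic).
      move=> /set_mem; rewrite /= in_itv/= => /andP[x0 _].
      by rewrite ifT//; apply/mem_set; rewrite /= in_itv/= x0.
    by case: ifP.
  - exact: continuous_subspaceT.
  - split; last 2 first.
      exact: cvg_at_right_filter (cF _).
      exact: cvg_at_left_filter (cF _).
    by move=> x _; have h := dF x; exact: ex_derive.
  - by move=> x _; have h := dF x; rewrite derive1E derive_val.
have : (F n.+1%:R - F 0) @[n --> \oo] --> \int[mu]_(x in `[0, +oo[) f x.
  rewrite (_ : (fun n => _) = fun n => fine (F n.+1%:R - F 0)%:E)//.
  under eq_fun do rewrite E.
  apply: fine_cvg; rewrite fineK; last exact: integrable_fin_num.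
  apply: (@dominated_cvg _ _ _ mu `[0, +oo[%classic _
    (fun n x => ((f \_ `[0, n.+1%:R]) x)%:E) (EFin \o f)
    (EFin \o (Num.norm \o f))) => //.
  - move=> n; apply/measurable_EFinP; apply/measurable_restrict => //.
    by apply: measurable_funTS; exact: continuous_measurable_fun.
  - move=> x; rewrite /= in_itv/= andbT => x0; apply: cvg_EFin; first exact: nearW.
    apply: cvg_near_cst; near=> n; rewrite /= patchE ifT// inE/= in_itv/= x0/=.
    rewrite (@le_trans _ _ n%:R)// ?ler_nat//.
    by near: n; exact: nbhs_infty_ger.
  - exact: integrable_norm.
  - move=> n x _; rewrite /= lee_fin patchE; case: ifPn => //.
    by rewrite normr0.
move=> h; rewrite [X in _ --> X]addrC.
have : (F n.+1%:R - F 0) + F 0 @[n --> \oo] -->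
    \int[mu]_(x in `[0, +oo[) f x + F 0.
  by apply: cvgD h _; exact: cvg_cst.
by under eq_fun do rewrite subrK.
Unshelve. all: by end_near. Qed.

(** For [x > 0], [beta * g beta k x] is the density of the Erlang law of order [k.+1]; the shifted
    index avoids the predecessor. *)
Let g beta k x : R := (beta * x) ^+ k / k`!%:R * expR (- (beta * x)).

(** The derivative of [g]; both branches read [beta (g_(k-1) - g_k)] with [g_(-1) = 0]. *)
Let dg beta k x : R := if k is j.+1 then beta * (g beta j x - g beta k x)
  else - beta * g beta 0 x.

Let is_derive_g beta k x : is_derive x 1 (g beta k) (dg beta k x).
Proof.
have He : is_derive x 1 (fun x => expR (- (beta * x)))
    (- beta * expR (- (beta * x))).
  by apply: is_derive_eq; rewrite /= /GRing.scale/=; ring.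
case: k => [|k].
  have -> : g beta 0 = (fun x => expR (- (beta * x))).
    by apply/funext => y; rewrite /g expr0 fact0 divr1 mul1r.
  by apply: is_derive_eq; rewrite /dg /g expr0 fact0 divr1 mul1r.
have -> : g beta k.+1 = (k.+1)`!%:R^-1 \*:
    ((beta \*: (id : R -> R)) ^+ k.+1 * (fun x => expR (- (beta * x)))).
  by apply/funext => y; rewrite /g /= fctE exprfctE /= /GRing.scale/=; ring.
apply: is_derive_eq.
rewrite /dg /g fctE /= /GRing.scale/= factS natrM exprS.
have h1 : (k`!%:R : R) != 0 by rewrite pnatr_eq0 -lt0n fact_gt0.
have h2 : (k.+1%:R : R) != 0 by rewrite pnatr_eq0.
by field; rewrite h1 addrC natr1 h2.
Qed.

Let continuous_g beta k : continuous (g beta k).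
Proof.
move=> x; apply: differentiable_continuous; apply/derivable1_diffP.
by have h := is_derive_g beta k x; exact: ex_derive.
Qed.

Let erlang_pdfE beta k :
  erlang_pdf k.+1 beta = (fun x => beta * g beta k x) \_ `]0, +oo[.
Proof.
apply/funext => x; rewrite patchE /erlang_pdf /g.
case: ifPn => x0; last first.
  by rewrite ifF//; apply: memNset; rewrite /= in_itv/= andbT; exact/negP.
by rewrite ifT ?inE/= ?in_itv/= ?x0//; ring.
Qed.

Lemma erlang_prob_dominates k beta : (0 < k)%N -> 0 < beta ->
  erlang_prob k beta `<< mu.
Proof.
move=> k0 b0; apply/null_content_dominatesP => A mA muA0.
rewrite /erlang_prob k0 b0/=; apply: null_set_integral => //.
apply/measurable_EFinP/measurable_funTS; exact: measurable_erlang_pdf.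
Qed.

Lemma integrable_erlang_pdf k beta : 0 < beta ->
  mu.-integrable setT (EFin \o erlang_pdf k beta).
Proof.
move=> b0; apply/integrableP; split.
  by apply/measurable_EFinP; exact: measurable_erlang_pdf.
under eq_integral do rewrite /= ger0_norm ?erlang_pdf_ge0//.
by rewrite integral_erlang_pdf// ltry.
Qed.

(** The Radon-Nikodym derivative of the law and [erlang_pdf] have the same integral over every
    measurable set, hence agree almost everywhere. *)
Lemma integral_erlang_prob k beta (f : measurableTypeR R -> \bar R) :
  (0 < k)%N -> 0 < beta ->
  (erlang_prob k beta).-integrable setT f ->
  (\int[erlang_prob k beta]_x f x =
   \int[mu]_x (f x * (erlang_pdf k beta x)%:E))%E.
Proof.
move=> k0 b0 intf.
have dom := erlang_prob_dominates k0 b0.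
rewrite -(Radon_Nikodym_change_of_variables dom)//=.
have mf : measurable_fun [set: measurableTypeR R] f := measurable_int _ intf.
have mp : measurable_fun [set: measurableTypeR R] (EFin \o erlang_pdf k beta).
  by apply/measurable_EFinP; exact: measurable_erlang_pdf.
apply: ae_eq_integral => //.
- exact: emeasurable_funM.
- exact: emeasurable_funM.
- apply: ae_eqe_mul2l => /=.
  rewrite Radon_NikodymE//=.
  case: cid => /= h [h1 h2 h3].
  apply: integral_ae_eq => //=.
  by move=> E _ mE; rewrite -h3//= /erlang_prob k0 b0.
Qed.

Let integrable_pdfM beta k (h : R -> R) (M : R) : 0 < beta ->
  measurable_fun [set: measurableTypeR R] h -> (forall x, `|h x| <= M) ->
  mu.-integrable setT (EFin \o (fun x => h x * erlang_pdf k.+1 beta x)).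
Proof.
move=> b0 mh hM.
have bh : [bounded h x | x in [set: measurableTypeR R]].
  exists M; split; first by rewrite num_real.
  by move=> y My x _; exact: le_trans (hM x) (ltW My).
exact: (integrableMr measurableT mh bh (integrable_erlang_pdf k.+1 b0)).
Qed.

Let restrict_pdfM beta k (h : R -> R) :
  (fun x => h x * erlang_pdf k.+1 beta x) =
  (fun x => beta * (h x * g beta k x)) \_ `]0, +oo[.
Proof.
apply/funext => x; rewrite erlang_pdfE !patchE.
by case: ifPn => _; [rewrite mulrCA|rewrite mulr0].
Qed.

Let measurable_gM beta k (h : R -> R) (D : set R) :
  measurable_fun [set: measurableTypeR R] h ->
  measurable_fun (D : set (measurableTypeR R))
    (fun x => beta * (h x * g beta k x)).
Proof.
move=> mh; apply: measurable_funTS; apply: measurable_funM => //.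
apply: measurable_funM => //.
by apply: continuous_measurable_fun; exact: continuous_g.
Qed.

Let integrable_gM beta k (h : R -> R) (M : R) : 0 < beta ->
  measurable_fun [set: measurableTypeR R] h -> (forall x, `|h x| <= M) ->
  mu.-integrable `[0, +oo[ (EFin \o (fun x => h x * g beta k x)).
Proof.
move=> b0 mh hM.
have /integrableP[_ i0] : mu.-integrable `]0, +oo[
    (EFin \o (fun x => beta * (h x * g beta k x))).
  apply/integrable_mkcond => //; rewrite restrict_EFin -restrict_pdfM.
  exact: integrable_pdfM mh hM.
(* The density lives on the open half-line but the fundamental theorem is used on the closed one;
   the endpoint is a null set. *)
have i1 : mu.-integrable `[0, +oo[
    (EFin \o (fun x => beta * (h x * g beta k x))).
  apply/integrableP; split.
    by apply/measurable_EFinP; exact: measurable_gM.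
  rewrite -integral_itv_obnd_cbnd//; apply: measurableT_comp => //.
  by apply/measurable_EFinP; exact: measurable_gM.
apply: eq_integrable (integrableZl _ beta^-1 i1) => //.
by move=> x _; rewrite /= -EFinM mulKf// gt_eqF.
Qed.

Let Rintegral_pdfM beta k (h : R -> R) (M : R) : 0 < beta ->
  measurable_fun [set: measurableTypeR R] h -> (forall x, `|h x| <= M) ->
  \int[mu]_x (h x * erlang_pdf k.+1 beta x) =
  beta * \int[mu]_(x in `[0, +oo[) (h x * g beta k x).
Proof.
move=> b0 mh hM; rewrite -RintegralZl//; last exact: (integrable_gM _ b0 mh hM).
rewrite restrict_pdfM -Rintegral_mkcond.
rewrite /Rintegral integral_itv_obnd_cbnd//.
by apply/measurable_EFinP; exact: measurable_gM.
Qed.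

Let Rintegral_erlang_prob beta k (h : R -> R) (M : R) : 0 < beta ->
  measurable_fun [set: measurableTypeR R] h -> (forall x, `|h x| <= M) ->
  \int[erlang_prob k.+1 beta]_x h x =
  beta * \int[mu]_(x in `[0, +oo[) (h x * g beta k x).
Proof.
move=> b0 mh hM; rewrite -(Rintegral_pdfM _ b0 mh hM).
rewrite /Rintegral integral_erlang_prob//.
exact: bounded_integrable mh hM.
Qed.

Let Rintegral_erlang_prob0 beta (h : R -> R) :
  measurable_fun [set: measurableTypeR R] h ->
  \int[erlang_prob 0 beta]_x h x = h 0.
Proof.
move=> mh; rewrite /Rintegral.
rewrite (eq_measure_integral (\d_(0 : measurableTypeR R))).
  by rewrite integral_dirac ?diracT ?mul1e//; exact/measurable_EFinP.
by move=> A _ _; rewrite /erlang_prob.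
Qed.

(** Integrating the derivative of [f * g beta k] over the half-line shows that the boundary term at
    infinity converges to the defect in the Stein identity. *)
Let erlang_stein_cvg beta k (f df : R -> R) (M : R) : 0 < beta ->
  (forall x : R, is_derive x 1 f (df x)) -> continuous df ->
  (forall x, `|f x| <= M) -> (forall x, `|df x| <= M) ->
  beta * (f n.+1%:R * g beta k n.+1%:R) @[n --> \oo] -->
  \int[erlang_prob k.+1 beta]_x df x -
  beta * (\int[erlang_prob k.+1 beta]_x f x - \int[erlang_prob k beta]_x f x).
Proof.
move=> b0 f_df cdf fM dfM.
have cf : continuous f.
  move=> x; apply: differentiable_continuous; apply/derivable1_diffP.
  by have h := f_df x; exact: ex_derive.
have mf : measurable_fun [set: measurableTypeR R] f.
  exact: continuous_measurable_fun.
have mdf : measurable_fun [set: measurableTypeR R] df.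
  exact: continuous_measurable_fun.
have idf j := integrable_gM j b0 mdf dfM.
have iif j := integrable_gM j b0 mf fM.
have cdg : continuous (dg beta k).
  move=> x; case: (k) => [|j]; rewrite /dg.
    by apply: cvgM; [exact: cvg_cst|exact: continuous_g].
  by apply: cvgM; [exact: cvg_cst|apply: cvgB; exact: continuous_g].
have dF x : is_derive x 1 (fun y => f y * g beta k y)
    (f x * dg beta k x + df x * g beta k x).
  have h1 := f_df x; have h2 := is_derive_g beta k x.
  by apply: is_derive_eq; rewrite /GRing.scale/=; ring.
have cdF : continuous (fun x => f x * dg beta k x + df x * g beta k x).
  move=> x; apply: cvgD; apply: cvgM; [exact: cf|exact: cdg|exact: cdf|].
  exact: continuous_g.
have idg : mu.-integrable `[0, +oo[ (EFin \o (fun x => f x * dg beta k x)).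
  case: (k) => [|j]; rewrite /dg.
    apply: (eq_integrable _ _ _ _ (integrableZl _ (- beta) (iif 0%N))) => //.
    by move=> x _; rewrite /= -EFinM; congr EFin; ring.
  apply: (eq_integrable _ _ _ _
    (integrableZl _ beta (integrableB _ (iif j) (iif j.+1)))) => //.
  by move=> x _; rewrite /= -EFinB -EFinM; congr EFin; ring.
pose c : R := f 0 * g beta k 0 +
  (\int[mu]_(x in `[0, +oo[) (f x * dg beta k x) +
   \int[mu]_(x in `[0, +oo[) (df x * g beta k x)).
have h : f n.+1%:R * g beta k n.+1%:R @[n --> \oo] --> c.
  rewrite /c -(RintegralD _ idg (idf k))//.
  exact: (cvg_FTC2y dF cdF (eq_integrable _ _ _ _ (integrableD _ idg (idf k)))).
set l := _ - _.
have -> : l = beta * c; last by apply: cvgM h; exact: cvg_cst.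
rewrite /l /c (Rintegral_erlang_prob _ b0 mdf dfM).
rewrite (Rintegral_erlang_prob _ b0 mf fM).
(* For [k = 0] the boundary value at [0] is [f 0], the expectation under the degenerate law of order
   [0]. For [k = j.+1] it vanishes, and [dg] supplies the expectation under the law of order [j.+1]
   instead. *)
case: (k) => [|j].
  rewrite Rintegral_erlang_prob0//.
  have -> : \int[mu]_(x in `[0, +oo[) (f x * dg beta 0 x) =
      - beta * \int[mu]_(x in `[0, +oo[) (f x * g beta 0 x).
    by rewrite -RintegralZl//; apply: eq_Rintegral => x _; rewrite /dg; ring.
  by rewrite {3}/g mulr0 oppr0 expR0 expr0 fact0; field.
rewrite (Rintegral_erlang_prob _ b0 mf fM).
have -> : \int[mu]_(x in `[0, +oo[) (f x * dg beta j.+1 x) =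
    beta * (\int[mu]_(x in `[0, +oo[) (f x * g beta j x) -
            \int[mu]_(x in `[0, +oo[) (f x * g beta j.+1 x)).
  rewrite -RintegralB// -RintegralZl//.
    by apply: eq_Rintegral => x _; rewrite /dg; ring.
  exact: (eq_integrable _ _ _ _ (integrableB _ (iif j) (iif j.+1))).
by rewrite [X in f 0 * X]/g mulr0 expr0n/= !mul0r; ring.
Qed.

Lemma erlang_stein beta k (f df : R -> R) (M : R) : 0 < beta ->
  (forall x : R, is_derive x 1 f (df x)) -> continuous df ->
  (forall x, `|f x| <= M) -> (forall x, `|df x| <= M) ->
  \int[erlang_prob k.+1 beta]_x df x =
  beta * (\int[erlang_prob k.+1 beta]_x f x - \int[erlang_prob k beta]_x f x).
Proof.
move=> b0 f_df cdf fM dfM.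
have Ecst j (c : R) : \int[erlang_prob j beta]_x (cst c x) = c.
  transitivity (c * fine (erlang_prob j beta [set: measurableTypeR R])).
    exact: Rintegral_cst.
  by rewrite probability_setT mulr1.
(* The case [f = 1] shows that the boundary term vanishes at infinity. *)
have g0 : beta * (1 * g beta k n.+1%:R) @[n --> \oo] --> 0.
  have dcst (x : R) : is_derive x 1 (cst 1 : R -> R) (cst 0 x).
    exact: is_derive_cst.
  have := @erlang_stein_cvg beta k (cst 1) (cst 0) 1 b0 dcst.
  rewrite !Ecst subrr mulr0 subr0; apply.
  - by move=> x; exact: cvg_cst.
  - by move=> x; rewrite normr1.
  - by move=> x; rewrite normr0.
apply/eqP; rewrite -subr_eq0; apply/eqP.
have h := erlang_stein_cvg (k := k) b0 f_df cdf fM dfM.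
suff h0 : beta * (f n.+1%:R * g beta k n.+1%:R) @[n --> \oo] --> 0.
  exact: cvg_unique h h0.
(* Since [|f| <= M], the boundary term of [f] is at most [M] times that of the constant [1]. *)
apply: (@squeeze_cvgr _ _ _ _ (fun n => - (M * (beta * (1 * g beta k n.+1%:R))))
  (fun n => M * (beta * (1 * g beta k n.+1%:R)))).
- apply: nearW => n; rewrite -ler_norml mul1r.
  have bg0 : 0 <= beta * g beta k n.+1%:R.
    by rewrite !mulr_ge0 ?expR_ge0 ?exprn_ge0 ?mulr_ge0// ltW.
  by rewrite mulrCA normrM (ger0_norm bg0) ler_wpM2r.
- by rewrite -oppr0 -(mulr0 M); apply: cvgN; apply: cvgM g0; exact: cvg_cst.
- by rewrite -(mulr0 M); apply: cvgM g0; exact: cvg_cst.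
Qed.


(** These are the Stein identities for [cos (u x)] and [sin (u x)], combined as real and imaginary
    parts. *)
Lemma charfun_erlang_probS beta k u : 0 < beta ->
  (beta -i* u) * charfun (erlang_prob k.+1 beta) u =
  beta%:C * charfun (erlang_prob k beta) u.
Proof.
move=> b0.
have dcos (x : R) : is_derive x 1 (fun x : R => cos (u * x)) (- u * sin (u * x)).
  by apply: is_derive_eq; rewrite /GRing.scale/=; ring.
have dsin (x : R) : is_derive x 1 (fun x : R => sin (u * x)) (u * cos (u * x)).
  by apply: is_derive_eq; rewrite /GRing.scale/=; ring.
have isin := bounded_integrable (erlang_prob k.+1 beta)
  (measurable_sinM u) (fun x => sin_max (u * x)).
have icos := bounded_integrable (erlang_prob k.+1 beta)
  (measurable_cosM u) (fun x => cos_max (u * x)).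
(* A common bound for the functions, by [1], and for their derivatives, by [|u|]. *)
pose M := 1 + `|u|.
have M1 : 1 <= M by rewrite lerDl.
have uM (y : R) : `|y| <= 1 -> `|u * y| <= M.
  by move=> y1; rewrite normrM (@le_trans _ _ `|u|) ?ler_piMr// lerDr.
have Es := @erlang_stein beta k _ _ M b0 dsin.
have Ec := @erlang_stein beta k _ _ M b0 dcos.
rewrite (RintegralZl _ measurableT icos) in Es.
rewrite (RintegralZl _ measurableT isin) in Ec.
have cc : continuous (fun x : R => - u * sin (u * x)).
  move=> x; apply: cvgM; first exact: cvg_cst.
  by apply: continuous_comp; [exact: mulrl_continuous|exact: continuous_sin].
have cs : continuous (fun x : R => u * cos (u * x)).
  move=> x; apply: cvgM; first exact: cvg_cst.
  by apply: continuous_comp; [exact: mulrl_continuous|exact: continuous_cos].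
have {}Es := Es cs (fun x => le_trans (sin_max _) M1) (fun x => uM _ (cos_max _)).
have uMN x : `|- u * sin (u * x)| <= M by rewrite mulNr normrN uM ?sin_max.
have {}Ec := Ec cc (fun x => le_trans (cos_max _) M1) uMN.
rewrite /charfun.
apply/eqP; rewrite eq_complex/=; apply/andP; split; apply/eqP.
  by rewrite Ec mul0r subr0 mulrBr subKr.
by rewrite mulNr Es mul0r addr0 mulrBr subKr.
Qed.

Lemma charfun_erlang_prob beta k u : 0 < beta ->
  charfun (erlang_prob k beta) u = (beta%:C / (beta -i* u)) ^+ k.
Proof.
move=> b0.
have z0 : beta -i* u != 0 by rewrite eq_complex/= gt_eqF.
elim: k => [|k IH].
  rewrite /charfun !Rintegral_erlang_prob0; last 2 first.
  - exact: measurable_sinM.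
  - exact: measurable_cosM.
  by rewrite mulr0 cos0 sin0 expr0.
apply: (mulfI z0); rewrite charfun_erlang_probS// IH exprS; field.
by [].
Qed.

End erlang_charfun.

(** * The binomial mixture of Erlang laws as the law of the remainder *)

Section erlang_mixture.
Context {R : realType}.
Notation mu := (@lebesgue_measure R).
Variables (n : nat) (beta a : R).
Hypothesis a01 : 0 < a < 1.

Let w k : R := 'C(n, k)%:R * a ^+ (n - k) * (1 - a) ^+ k.

Let w_ge0 k : 0 <= w k.
Proof.
case/andP: a01 => a0 a1.
by rewrite !mulr_ge0// exprn_ge0// ?subr_ge0 ltW.
Qed.

Let sum_w : \sum_(k < n.+1) w k = 1.
Proof.
transitivity ((a + (1 - a)) ^+ n); last by rewrite subrKC expr1n.
by rewrite exprDn; apply: eq_bigr => k _; rewrite /w -mulrA mulr_natl.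
Qed.

(** As a sum of scaled measures it inherits sigma-additivity, so that only the total mass has to be
    computed. *)
Definition erlang_mixture : set (measurableTypeR R) -> \bar R :=
  msum (fun k => mscale (NngNum (w_ge0 k)) (erlang_prob k beta)) n.+1.

HB.instance Definition _ := Measure.on erlang_mixture.

Let erlang_mixture_setT : erlang_mixture setT = 1%E.
Proof.
rewrite -sum_w -sumEFin /erlang_mixture /msum; apply: eq_bigr => k _.
rewrite /= /mscale/= [X in (_ * X)%E](_ : _ = 1%E) ?mule1//.
exact: probability_setT.
Qed.

HB.instance Definition _ :=
  @Measure_isProbability.Build _ _ R erlang_mixture erlang_mixture_setT.

Lemma erlang_mixtureE A : erlang_mixture A =
  (\sum_(0 <= k < n.+1) (w k)%:E * erlang_prob k beta A)%E.
Proof. by rewrite big_mkord. Qed.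

(** Integration against a sum of measures is additive for nonnegative integrands, so [f] is shifted
    to [f + M]. The shift cancels because the weights and all the laws have total mass one. *)
Lemma Rintegral_erlang_mixture (f : measurableTypeR R -> R) (M : R) :
  measurable_fun setT f -> (forall x, `|f x| <= M) ->
  \int[erlang_mixture]_x f x =
  \sum_(0 <= k < n.+1) w k * \int[erlang_prob k beta]_x f x.
Proof.
move=> mf fM.
have fM0 x : 0 <= f x + M by rewrite -lerBlDr sub0r (lerNnormlW (fM x)).
have mfM : measurable_fun setT (fun x => f x + M) by exact: measurable_funD.
have fM2 x : `|f x + M| <= M + M.
  by rewrite ger0_norm// lerD2r (le_trans (ler_norm _)).
have E (W : probability (measurableTypeR R) R) :
    \int[W]_x (f x + M) = \int[W]_x f x + M.
  rewrite RintegralD//.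
  - congr +%R; transitivity (M * fine (W [set: measurableTypeR R])).
      exact: Rintegral_cst.
    by rewrite probability_setT mulr1.
  - exact: bounded_integrable mf fM.
  - exact: finite_measure_integrable_cst.
have H : \int[erlang_mixture]_x (f x + M) =
    \sum_(0 <= k < n.+1) w k * \int[erlang_prob k beta]_x (f x + M).
  rewrite /Rintegral /erlang_mixture ge0_integral_measure_sum//; last 2 first.
  - by move=> x _; rewrite lee_fin.
  - exact/measurable_EFinP.
  rewrite big_mkord -sum_fine.
    apply: eq_bigr => k _; rewrite ge0_integral_mscale//; last 2 first.
    - exact/measurable_EFinP.
    - by move=> x _; rewrite lee_fin.
    rewrite fineM//; apply: integrable_fin_num => //.
    exact: bounded_integrable mfM fM2.
  move=> k _; rewrite ge0_integral_mscale//; last 2 first.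
  - exact/measurable_EFinP.
  - by move=> x _; rewrite lee_fin.
  rewrite fin_numM//; apply: integrable_fin_num => //.
  exact: bounded_integrable mfM fM2.
apply: (addIr M); rewrite -E H big_mkord [in RHS]big_mkord.
rewrite -[X in _ + X]mul1r -sum_w mulr_suml -big_split/=.
by apply: eq_bigr => k _; rewrite E mulrDr.
Qed.

Lemma charfun_erlang_mixture u : 0 < beta ->
  charfun erlang_mixture u =
  \sum_(0 <= k < n.+1) (w k)%:C * (beta%:C / (beta -i* u)) ^+ k.
Proof.
move=> b0.
transitivity (\sum_(0 <= k < n.+1) (w k)%:C *
    charfun (erlang_prob k beta) u); last first.
  by apply: eq_bigr => k _; rewrite charfun_erlang_prob.
rewrite /charfun.
rewrite (Rintegral_erlang_mixture (measurable_cosM u) (fun x => cos_max _)).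
rewrite (Rintegral_erlang_mixture (measurable_sinM u) (fun x => sin_max _)).
elim: n.+1 => [|m IH]; first by rewrite !big_geq.
rewrite !big_nat_recr//= -IH; apply/eqP.
by rewrite eq_complex/= !mul0r subr0 addr0 !eqxx.
Qed.

Lemma charfun_erlang_mixtureX u : 0 < beta ->
  charfun erlang_mixture u = ((beta -i* (a * u)) / (beta -i* u)) ^+ n.
Proof.
move=> b0; rewrite charfun_erlang_mixture// big_mkord.
have z0 : beta -i* u != 0 by rewrite eq_complex/= gt_eqF.
have -> : (beta -i* (a * u)) / (beta -i* u) =
    a%:C + (1 - a)%:C * (beta%:C / (beta -i* u)).
  apply: (mulIf z0); rewrite divfK// mulrDl -mulrA divfK//.
  by apply/eqP; rewrite eq_complex/=; apply/andP; split; apply/eqP; ring.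
rewrite exprDn; apply: eq_bigr => k _.
have natC m : (m%:R : R)%:C = m%:R by rewrite (rmorph_nat (real_complex R)).
rewrite /w !(rmorphM (real_complex R)) !(rmorphXn (real_complex R))/= natC.
(* The quotient is made opaque so that [exprMn] acts only on its product with [1 - a]. *)
by move: (_ / _) => z; rewrite exprMn -[RHS]mulr_natl !mulrA.
Qed.

Lemma remainder_erlang_mixture : 0 < beta ->
  remainder_law a (erlang_prob n beta) erlang_mixture.
Proof.
move=> b0 u; rewrite charfun_erlang_mixtureX// !charfun_erlang_prob// -exprMn.
congr (_ ^+ _).
have z0 : beta -i* (a * u) != 0 by rewrite eq_complex/= gt_eqF.
by rewrite mulrA divfK.
Qed.

Lemma remainder_erlang_unique Q : 0 < beta ->
  remainder_law a (erlang_prob n beta) Q ->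
  forall A, measurable A -> Q A = erlang_mixture A.
Proof.
move=> b0 HQ; apply: charfun_inj => u.
have z0 (v : R) : beta -i* v != 0 by rewrite eq_complex/= gt_eqF.
have c0 : charfun (erlang_prob n beta) (a * u) != 0.
  rewrite charfun_erlang_prob// expf_neq0// mulf_neq0 ?invr_neq0//.
  by rewrite eq_complex/= gt_eqF.
by apply: (mulfI c0); rewrite -HQ -remainder_erlang_mixture.
Qed.

Lemma erlang_mixture_density A : 0 < beta -> measurable A ->
  erlang_mixture A = ((a ^+ n)%:E * \d_(0%R : measurableTypeR R) A +
    \int[mu]_(x in A) (remainder_pdf n beta a x)%:E)%E.
Proof.
(* The term [k = 0] is the atom: its weight is [a ^+ n] and its law the Dirac mass at [0]. All other
   indices are successors, where [erlang_prob] is given by the density. *)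
move=> b0 mA; rewrite erlang_mixtureE big_nat_recl//; congr (_ + _)%E.
  by rewrite /w bin0 subn0 expr0 mulr1 mul1r /erlang_prob.
rewrite /remainder_pdf.
under [RHS]eq_integral do rewrite big_add1/= -sumEFin.
rewrite ge0_integral_sum//; last 2 first.
- move=> k; apply/measurable_EFinP/measurable_funTS; apply: measurable_funM => //.
  exact: measurable_erlang_pdf.
- by move=> k x _; rewrite lee_fin mulr_ge0 ?erlang_pdf_ge0//; exact: w_ge0.
apply: eq_bigr => k _; under [RHS]eq_integral do rewrite EFinM.
rewrite ge0_integralZl//.
- by rewrite /erlang_prob b0.
- by apply/measurable_EFinP/measurable_funTS; exact: measurable_erlang_pdf.
- by move=> x _; rewrite lee_fin erlang_pdf_ge0.
- by rewrite lee_fin; exact: w_ge0.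
Qed.

Lemma remainder_pdf_neq0 : (0 < n)%N -> 0 < beta ->
  [set x | remainder_pdf n beta a x != 0] = `]0, +oo[%classic.
Proof.
move=> n0 b0; case/andP: (a01) => a0 a1.
apply/seteqP; split => x /=; rewrite in_itv/= andbT.
  apply: contraNT => x0; rewrite /remainder_pdf big1// => k _.
  by rewrite /erlang_pdf (negbTE x0) mulr0.
(* The last term [k = n], present as [0 < n], is positive on [x > 0], and the others are
   nonnegative. *)
move=> x0; rewrite gt_eqF// /remainder_pdf big_nat_recr//=.
rewrite ltr_pwDr ?sumr_ge0//.
  rewrite !mulr_gt0 ?ltr0n ?bin_gt0 ?exprn_gt0 ?subr_gt0//.
  rewrite /erlang_pdf x0 !mulr_gt0 ?invr_gt0 ?ltr0n ?fact_gt0 ?expR_gt0//.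
  by rewrite exprn_gt0 ?mulr_gt0.
by move=> k _; rewrite mulr_ge0 ?erlang_pdf_ge0//; exact: w_ge0.
Qed.

(** This identifies the weights [w] with the masses of the binomial law of success probability
    [1 - a], which lies in [[0, 1]]. *)
Lemma binomial_prob_set1 k : (k <= n)%N ->
  binomial_prob n (1 - a) [set k] = (w k)%:E.
Proof.
move=> kn; case/andP: (a01) => a0 a1.
rewrite /binomial_prob ifT; last by rewrite subr_ge0 ltW//= gerBl ltW.
rewrite esum_set1.
  congr EFin.
  transitivity ((1 - a) ^+ k * (1 - (1 - a)) ^+ (n - k) *+ 'C(n, k)) => //.
  by rewrite subKr -mulr_natl [X in _ * X]mulrC mulrA.
by rewrite lee_fin binomial_pmf_ge0// subr_ge0 ltW//= gerBl ltW.
Qed.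

End erlang_mixture.

(** * Existence and description of the law of the remainder *)

Theorem theorem2p6 (R : realType) (n : nat) (beta a : R) :
  (0 < n)%N -> 0 < beta -> 0 < a < 1 ->
  (exists Q : probability (measurableTypeR R) R,
     remainder_law a (erlang_prob n beta) Q) /\
  forall Q : probability (measurableTypeR R) R,
    remainder_law a (erlang_prob n beta) Q ->
    [/\ forall A : set (measurableTypeR R), measurable A ->
          Q A = (\sum_(0 <= k < n.+1)
                  binomial_prob n (1 - a)%R [set k] * erlang_prob k beta A)%E,
        forall u : R,
          charfun Q u = \sum_(0 <= k < n.+1)
            ('C(n, k)%:R * a ^+ (n - k) * (1 - a) ^+ k)%:C *
              (beta%:C / (beta -i* u)) ^+ k,
        forall A : set (measurableTypeR R), measurable A ->
          Q A = ((a ^+ n)%:E * \d_(0%R : measurableTypeR R) A +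
                 \int[lebesgue_measure]_(x in A)
                   (remainder_pdf n beta a x)%:E)%E
      & [set x | remainder_pdf n beta a x != 0] = `]0, +oo[%classic].
Proof.
move=> n0 b0 a01; split.
  by exists (erlang_mixture n beta a01); exact: remainder_erlang_mixture.
move=> Q HQ.
(* Any law of the remainder agrees with the mixture on measurable sets, so the claims on [Q] become
   claims on the mixture. *)
have QE := remainder_erlang_unique a01 b0 HQ.
split.
- move=> A mA; rewrite QE// erlang_mixtureE; apply: eq_big_nat => k /andP[_ kn].
  by rewrite binomial_prob_set1.
- move=> u; rewrite -(charfun_erlang_mixture n a01)//.
  rewrite /charfun /Rintegral; congr (fine _ +i* fine _).
  + by apply: eq_measure_integral => A mA _; exact: QE.
  + by apply: eq_measure_integral => A mA _; exact: QE.
- by move=> A mA; rewrite QE// erlang_mixture_density.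
- exact: remainder_pdf_neq0.
Qed.
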